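(* Let $H$ be a Hilbert space, let $K:\ell^2\to H$ be a bounded linear operator that obeys the FBI property, and let $g\in H$ and $\alpha>0$. Then the projection proximal-point algorithm for $\ell^1$-minimization (described in the context), applied to the problem of minimizing $\Psi(u)=\tfrac12\|Ku-g\|_H^2+\alpha\|u\|_1$ over $u\in\ell^2$, converges globally and $Q$-linearly.
   Context: $\ell^2=\ell^2(\mathbf{N})$ is the space of square-summable real sequences with norm $\|\cdot\|=\|\cdot\|_2$ and inner product $\langle\cdot,\cdot\rangle$ (the same symbols are used for the norm and inner product of $H$); $\|u\|_1=\sum_k|u_k|\in[0,\infty]$; $K^*$ is the adjoint of $K$ and $\mathrm{id}$ is the identity. FBI property: an operator $K:\ell^2\to H$ has the finite basis injectivity (FBI) property if for all finite subsets $I\subset\mathbf{N}$ the restriction $K|_I$ is injective, i.e. for all $u,v\in\ell^2$ with $Ku=Kv$ and $u_k=v_k=0$ for all $k\notin I$ it follows that $u=v$. Convergence: ''globally'' means for every starting point $u^0\in\ell^2$, and the convergence is that of the outer iterates $u^n$ to a minimizer $\bar u$ of $\Psi$ in the norm of $\ell^2$; ''$Q$-linearly'' means that there is $q\in[0,1[$ with $\|u^{n+1}-\bar u\|\le q\|u^n-\bar u\|$ for all sufficiently large $n$. Soft-thresholding: for $c>0$, $S_c$ acts componentwise by $S_c(u)_k=u_k-c$ if $u_k>c$, $S_c(u)_k=0$ if $|u_k|\le c$, and $S_c(u)_k=u_k+c$ if $u_k<-c$. Projection: for $y\in\ell^2$, $P_{\alpha\mathrm{Sign}(y)}$ acts componentwise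 by $P_{\alpha\mathrm{Sign}(y)}(u)_i=\alpha$ if $y_i>0$ or ($y_i=0$ and $u_i>\alpha$); $=-\alpha$ if $y_i<0$ or ($y_i=0$ and $u_i<-\alpha$); $=u_i$ if $y_i=0$ and $|u_i|\le\alpha$. Algorithm. Given $u^0\in\ell^2$ and $\sigma\in[0,1[$, for $n=0,1,2,\dots$ do the following. (1) Choose $\mu_n>0$ and $y^0$. (2) Inner loop: for $k=1,2,\dots$ calculate $y^k$ from $y^{k-1}$ via one step of either of the following two methods. (a) Damped iterative soft-thresholding: choose $s_{k-1}$ with $0<\underline{s}\le s_{k-1}\le\bar s<2/\|K\|^2$ ($\underline{s},\bar s$ given) and set $y^k=\frac{1}{1+s_{k-1}\mu_n}S_{s_{k-1}\alpha}\bigl(y^{k-1}-s_{k-1}K^*(Ky^{k-1}-g)+s_{k-1}\mu_nu^n\bigr)$. (b) Generalized conditional gradient method: with $\Phi(u)=\alpha\|u\|_1+\frac{\mu_n}{2}\|u-u^n\|^2$, let $w^{k-1}$ be a minimizer over $w$ of $\langle K^*(Ky^{k-1}-g),w\rangle+\Phi(w)$, let $s_{k-1}=\min\Bigl\{1,\frac{\Phi(y^{k-1})-\Phi(w^{k-1})+\langle Ky^{k-1}-g,K(y^{k-1}-w^{k-1})\rangle}{\|K(y^{k-1}-w^{k-1})\|^2}\Bigr\}$, and set $y^k=y^{k-1}+s_{k-1}(w^{k-1}-y^{k-1})$. After each such step calculate $\epsilon^k=(\mathrm{id}-P_{\alpha\mathrm{Sign}(y^k)})\bigl(-K^*(Ky^k-g)-\mu_n(y^k-u^n)\bigr)$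 and $v^k=-\mu_n(y^k-u^n)-\epsilon^k$. If $\|\epsilon^k\|\le\sigma\max\{\|v^k\|,\mu_n\|y^k-u^n\|\}$, the inner loop ends, and the accepted pair $(y^k,v^k)$ is denoted $(y^n,v^n)$; otherwise continue with $k+1$. (3) If $v^n=0$ or $y^n=u^n$, stop. Otherwise set $u^{n+1}=u^n-\frac{\langle v^n,u^n-y^n\rangle}{\|v^n\|^2}v^n$ and continue with $n+1$.
   Formalization: For runs that never stop, the chosen parameters μ_n are assumed bounded above; with unbounded μ_n (e.g. K = id, σ = 0, s = 1, μ_n = C·4^n, C large) the iterates need not reach a minimizer. *)

(* Defs.v *)
From HB Require Import structures.
From mathcomp Require Import all_boot all_order all_algebra.
From mathcomp Require Import all_classical all_reals all_analysis.
From mathcomp Require Import ring lra.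

Set Implicit Arguments.
Unset Strict Implicit.
Unset Printing Implicit Defensive.
Import Order.TTheory GRing.Theory Num.Theory.
Import numFieldNormedType.Exports.
Local Open Scope classical_set_scope.
Local Open Scope ring_scope.

(* Real inner product spaces (complete or not): a positive definite symmetric
   form that induces the norm. *)
HB.mixin Record NormedModule_isInnerProduct (R : realType) V
    & NormedModule R V := {
  inner : {dot V for (idfun : R -> R)} ;
  inner_norm : forall u : V, inner u u = `|u| ^+ 2
}.

#[short(type="innerProductType")]
HB.structure Definition InnerProduct (R : realType) :=
  {V of NormedModule R V & NormedModule_isInnerProduct R V}.

#[short(type="hilbertType")]
HB.structure Definition Hilbert (R : realType) :=
  {V of InnerProduct R V & CompleteNormedModule R V}.

Notation "<| u , v |>" := (inner u v)
  (at level 0, u, v at level 99, format "<| u ,  v |>") : ring_scope.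

Section Ell2.
Variable R : realType.
Implicit Types (f g : nat -> R) (a : R).

Definition square_summable : {pred nat -> R} :=
  [pred f : nat -> R | `[< cvgn (series (fun k => f k ^+ 2)) >]].

Lemma square_summableP f :
  reflect (cvgn (series (fun k => f k ^+ 2))) (f \in square_summable).
Proof. exact: asboolP. Qed.

Lemma square_summableD f g : f \in square_summable -> g \in square_summable ->
  f + g \in square_summable.
Proof.
move=> /square_summableP cf /square_summableP cg; apply/square_summableP.
apply: (@series_le_cvg _ _
  (2 *: ((fun k => f k ^+ 2) + (fun k => g k ^+ 2)) : R ^nat)).
- by move=> k; rewrite sqr_ge0.
- by move=> k; rewrite mulr_ge0// addr_ge0// sqr_ge0.
- move=> k; rewrite -subr_ge0.
  rewrite [X in 0 <= X](_ : _ = (f k - g k) ^+ 2) ?sqr_ge0//.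
  rewrite !fctE /GRing.scale/=; ring.
- by apply: is_cvg_seriesZ; rewrite seriesD; apply: is_cvgD.
Qed.

Lemma square_summableZ a f : f \in square_summable ->
  a *: f \in square_summable.
Proof.
move=> /square_summableP cf; apply/square_summableP.
rewrite (_ : (fun k => _) = a ^+ 2 *: (fun k => f k ^+ 2)); last first.
  by apply/funext => k; rewrite !fctE /GRing.scale/= exprMn.
exact: is_cvg_seriesZ.
Qed.

Lemma square_summable_submod : submod_closed square_summable.
Proof.
split.
  apply/square_summableP; rewrite (_ : (fun k => _) = (fun=> 0)).
    by rewrite (_ : series _ = (fun=> 0)) ?funeqE => [|n]; [exact: is_cvg_cst|
      rewrite /series/= big1].
  by apply/funext => k; exact: (expr0n R 2).
by move=> a f g sf sg; rewrite square_summableD// square_summableZ.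
Qed.

HB.instance Definition _ :=
  GRing.isSubmodClosed.Build R (nat -> R) square_summable square_summable_submod.

Record ell2 := Ell2 {
  ell2_seq :> nat -> R ; ell2_seqP : ell2_seq \in square_summable }.

HB.instance Definition _ := [isSub for ell2_seq].
HB.instance Definition _ := [Choice of ell2 by <:].
HB.instance Definition _ := [SubChoice_isSubLmodule of ell2 by <:].


Definition ell2_dot (u v : ell2) : R := limn (series (fun k => u k * v k)).

Lemma ell2_dot_cvg (u v : ell2) : cvgn (series (fun k => u k * v k)).
Proof.
apply: (@normed_cvg _ R^o).
apply: (@series_le_cvg _ _
  (((fun k => u k ^+ 2) + (fun k => v k ^+ 2)) : R ^nat)).
- by move=> k; rewrite /= normr_ge0.
- by move=> k; rewrite addr_ge0// sqr_ge0.
- move=> k; rewrite -[leRHS]/(u k ^+ 2 + v k ^+ 2) ler_norml; apply/andP.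
  have := sqr_ge0 (u k - v k); have := sqr_ge0 (u k + v k).
  by have := sqr_ge0 (u k); have := sqr_ge0 (v k); split; nra.
- by rewrite seriesD; apply: is_cvgD; exact/square_summableP/ell2_seqP.
Qed.

Lemma ell2_dotC (u v : ell2) : ell2_dot u v = ell2_dot v u.
Proof. by congr (limn (series _)); apply/funext => k; rewrite mulrC. Qed.

Lemma ell2_dot_linear (u : ell2) : linear_for *%R (ell2_dot u).
Proof.
move=> a v w; rewrite /ell2_dot.
rewrite (_ : (fun k => _) =
    a *: (fun k => u k * v k) + (fun k => u k * w k)); last first.
  apply/funext => k; rewrite -[LHS]/(u k * (a * v k + w k)).
  by rewrite -[RHS]/(a * (u k * v k) + u k * w k); ring.
have cv := @ell2_dot_cvg u v; have cw := @ell2_dot_cvg u w.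
have cav := is_cvg_seriesZ (k := a) cv.
by rewrite lim_seriesD// lim_seriesZ.
Qed.

Lemma ell2_dot_bilinear : bilinear_for *%R (idfun \; *%R) ell2_dot.
Proof.
split=> [v a u u'|u a v v'] /=; last exact: ell2_dot_linear.
by rewrite !(ell2_dotC _ v); exact: ell2_dot_linear.
Qed.

Lemma ell2_dot_hermitian (u v : ell2) :
  ell2_dot u v = (-1) ^+ false * idfun (ell2_dot v u).
Proof. by rewrite expr0 mul1r ell2_dotC. Qed.

Lemma ell2_dot_gt0 (u : ell2) : u != 0 -> 0 < ell2_dot u u.
Proof.
move=> u0; have [k uk0] : exists k, u k != 0.
  apply: contrapT => /forallNP uE; move/negP: u0; apply; apply/eqP.
  by apply/val_inj/funext => k; apply/eqP/negPn/negP/uE.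
have uk : 0 < u k * u k by rewrite -expr2 exprn_even_gt0.
apply: (lt_le_trans uk).
apply: (@le_trans _ _ (series (fun i => u i * u i) k.+1)).
  by rewrite /series/= big_nat_recr//= lerDr sumr_ge0// => i _; rewrite -expr2 sqr_ge0.
apply: nondecreasing_cvgn_le; last exact: ell2_dot_cvg.
by apply: nondecreasing_series => i _ _; rewrite -expr2 sqr_ge0.
Qed.

HB.instance Definition _ := bilinear_isBilinear.Build R ell2 ell2 R
  *%R (idfun \; *%R) ell2_dot ell2_dot_bilinear.
HB.instance Definition _ :=
  isHermitianSesquilinear.Build R ell2 false idfun ell2_dot ell2_dot_hermitian.
HB.instance Definition _ := isDotProduct.Build R ell2 ell2_dot ell2_dot_gt0.


Definition ell2_norm (u : ell2) : R := Num.sqrt (ell2_dot u u).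

Lemma ell2_dot_ge0 (u : ell2) : 0 <= ell2_dot u u.
Proof.
have [->|/ell2_dot_gt0/ltW//] := eqVneq u 0.
by rewrite linear0l.
Qed.

Lemma ell2_dot_le_norm (u v : ell2) : ell2_dot u v <= ell2_norm u * ell2_norm v.
Proof.
have [->|v0] := eqVneq v 0.
  by rewrite linear0r mulr_ge0// sqrtr_ge0.
have vv := ell2_dot_gt0 v0.
rewrite /ell2_norm -sqrtrM ?ell2_dot_ge0//.
apply: le_trans (ler_norm _) _; rewrite -sqrtr_sqr ler_wsqrtr//.
have := ell2_dot_ge0 (ell2_dot v v *: u - ell2_dot u v *: v).
rewrite !(linearBl, linearBr, linearZl_LR, linearZr_LR)/= (ell2_dotC v u).
move=> h.
suff : 0 <= ell2_dot v v * (ell2_dot u u * ell2_dot v v - ell2_dot u v ^+ 2).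
  by rewrite pmulr_rge0// subr_ge0.
by apply: le_trans h _; rewrite le_eqVlt; apply/orP; left; apply/eqP; ring.
Qed.

Lemma ell2_normD (u v : ell2) : ell2_norm (u + v) <= ell2_norm u + ell2_norm v.
Proof.
rewrite -ler_sqr ?nnegrE ?addr_ge0 ?sqrtr_ge0//.
rewrite sqr_sqrtr ?ell2_dot_ge0// sqrrD !sqr_sqrtr ?ell2_dot_ge0//.
rewrite !(linearDl, linearDr)/= (ell2_dotC v u).
by have := ell2_dot_le_norm u v; lra.
Qed.

Lemma ell2_normZ a (u : ell2) : ell2_norm (a *: u) = `|a| * ell2_norm u.
Proof.
rewrite /ell2_norm linearZl_LR linearZr_LR/= mulrA -expr2.
by rewrite sqrtrM ?sqr_ge0// sqrtr_sqr.
Qed.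

Lemma ell2_norm0_eq0 (u : ell2) : ell2_norm u = 0 -> u = 0.
Proof.
move=> n0; apply: contrapT => /eqP /ell2_dot_gt0.
by rewrite -sqrtr_gt0 -/(ell2_norm u) n0 ltxx.
Qed.

HB.instance Definition _ :=
  Lmodule_isNormed.Build R ell2 ell2_normD ell2_normZ ell2_norm0_eq0.

Lemma ell2_inner_norm (u : ell2) : ell2_dot u u = `|u| ^+ 2.
Proof. by rewrite [RHS]sqr_sqrtr// ell2_dot_ge0. Qed.

HB.instance Definition _ := NormedModule_isInnerProduct.Build R ell2
  (ell2_inner_norm : forall u, (ell2_dot : {dot _ for _}) u u = `|u| ^+ 2).

End Ell2.

Section Operators.
Variables (R : realType) (H : hilbertType R).
Implicit Types K : {linear ell2 R -> H}.

Definition bounded_operator K : Prop :=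
  exists C : R, forall u, `|K u| <= C * `|u|.

Definition opnorm K : R := sup [set `|K u| | u in [set u | `|u| <= 1]].

(* For a bounded [K] such an element exists and is unique, by Riesz. *)
Definition adjoint K (h : H) : ell2 R :=
  get [set a : ell2 R | forall u, <| K u, h |> = <| u, a |>].

Definition finite_basis_injective K : Prop :=
  forall I : set nat, finite_set I -> forall u v : ell2 R,
    (forall k, ~ I k -> u k = 0 /\ v k = 0) -> K u = K v -> u = v.

End Operators.

Definition is_minimizer (R : realType) (T : Type) (F : T -> \bar R) (x : T) :=
  forall z, (F x <= F z)%E.

Definition norm1 (R : realType) (u : nat -> R) : \bar R :=
  (\sum_(0 <= k <oo) `|u k|%:E)%E.

Definition soft (R : realType) (c x : R) : R :=
  if c < x then x - c else if x < - c then x + c else 0.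

Definition proj_sign (R : realType) (alpha y x : R) : R :=
  if (0 < y) || (y == 0) && (alpha < x) then alpha
  else if (y < 0) || (y == 0) && (x < - alpha) then - alpha
  else x.

Section Algorithm.
Variables (R : realType) (H : hilbertType R).
Variables (K : {linear ell2 R -> H}) (g : H) (alpha : R).
Implicit Types (u v w y eps : ell2 R) (mu s : R).

Definition Psi u : \bar R :=
  ((2^-1 * `|K u - g| ^+ 2)%:E + alpha%:E * norm1 u)%E.

Definition ist_step mu u s y y' : Prop :=
  forall i, y' i = (1 + s * mu)^-1 *
    soft (s * alpha) ((y - s *: adjoint K (K y - g) + (s * mu) *: u) i).

Definition Phi mu u w : \bar R :=
  (alpha%:E * norm1 w + (mu / 2 * `|w - u| ^+ 2)%:E)%E.

(* The quotient is taken in [\bar R]: it is [+oo] if [norm1 y = +oo] (so the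
   step is 1), and its numerator is nonnegative since [w] is a minimizer. If the
   denominator is 0, it is [+oo] for a positive numerator, and 0 for a zero one,
   in which case [w = y]. *)
Definition gcg_stepsize mu u y w : R :=
  fine (Order.min 1%E
    ((Phi mu u y - Phi mu u w + (<| K y - g, K (y - w) |>)%:E)
     * ((`|K (y - w)| ^+ 2)%:E)^-1)%E).

Definition gcg_step mu u y y' : Prop :=
  exists2 w, is_minimizer
      (fun w => (<| adjoint K (K y - g), w |>)%:E + Phi mu u w)%E w &
    y' = y + gcg_stepsize mu u y w *: (w - y).

Definition inner_step (smin smax : R) mu u y y' : Prop :=
  (exists2 s, smin <= s <= smax & ist_step mu u s y y') \/ gcg_step mu u y y'.

Definition residual mu u y : nat -> R := fun i =>
  let x := (- adjoint K (K y - g) - mu *: (y - u)) i in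
  x - proj_sign alpha (y i) x.

(* The residual need not be square-summable (it is if [y] has finite support);
   the test then fails. *)
Definition accepted (sigma : R) mu u y v : Prop :=
  exists eps, [/\ eps = residual mu u y :> (nat -> R),
    v = - mu *: (y - u) - eps &
    `|eps| <= sigma * Order.max `|v| (mu * `|y - u|)].

Definition inner_loop (smin smax sigma : R) mu u y v : Prop :=
  exists (z : nat -> ell2 R) (m : nat),
    [/\ (forall k, (k <= m)%N -> inner_step smin smax mu u (z k) (z k.+1)),
        (forall k, (0 < k <= m)%N -> ~ exists v', accepted sigma mu u (z k) v'),
        z m.+1 = y &
        accepted sigma mu u y v].

Definition outer_step (smin smax sigma : R) (mu : R ^nat)
    (u y v : (ell2 R) ^nat) (n : nat) : Prop :=
  0 < mu n /\ inner_loop smin smax sigma (mu n) (u n) (y n) (v n).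

Definition stops (u y v : (ell2 R) ^nat) (n : nat) : Prop :=
  v n = 0 \/ y n = u n.

Definition advances (smin smax sigma : R) (mu : R ^nat)
    (u y v : (ell2 R) ^nat) (n : nat) : Prop :=
  [/\ outer_step smin smax sigma mu u y v n,
      ~ stops u y v n &
      u n.+1 = u n - (<| v n, u n - y n |> / `|v n| ^+ 2) *: v n].

Definition infinite_run (smin smax sigma : R) (mu : R ^nat)
    (u y v : (ell2 R) ^nat) : Prop :=
  forall n, advances smin smax sigma mu u y v n.

Definition stopped_run (smin smax sigma : R) (mu : R ^nat)
    (u y v : (ell2 R) ^nat) (N : nat) : Prop :=
  [/\ (forall n, (n < N)%N -> advances smin smax sigma mu u y v n),
      outer_step smin smax sigma mu u y v N &
      stops u y v N].

End Algorithm.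

Definition Q_linearly (R : realType) (V : normedModType R) (u : V ^nat)
    (l : V) : Prop :=
  exists2 q : R, 0 <= q < 1 & \forall n \near \oo, `|u n.+1 - l| <= q * `|u n - l|.

(* Main.v *)
Require Import Defs.
From mathcomp Require Import all_boot all_order all_algebra.
From mathcomp Require Import all_classical all_reals all_analysis.
From mathcomp Require Import ring lra.

(* Write the subdifferential of Psi at [y] as [K^*(K y - g) + alpha Sign(y)].
   An accepted pair [(y, v)] has [v] in it, and the relative error test gives
   [mu <v, u - y> >= (1 - sigma^2)/2 max(|v|, mu |y - u|)^2]; whatever produced
   [y], the outer step is thus the projection onto a hyperplane separating [u]
   from every minimizer, so the distance to a minimizer [ub] decreases with a
   gain controlled by [rho = max(|v|, mu |y - u|) / mu], which forces [rho -> 0].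
   Linear convergence follows from the error bound [|y - ub| <= kappa |v|] for
   small [v]: the entries of [-K^*(K ub - g)] tend to 0, so all but finitely many
   are below [alpha] by a margin; this persists for [y], hence [y - ub] has its
   support in a fixed finite set, on which FBI bounds [K] from below. The same
   margin argument, applied to minimizers over the spans of the first N unit
   vectors, shows that their supports stop growing, so a minimizer exists. *)

Set Implicit Arguments.
Unset Strict Implicit.
Unset Printing Implicit Defensive.
Import Order.TTheory GRing.Theory Num.Theory.
Import numFieldNormedType.Exports.
Local Open Scope classical_set_scope.
Local Open Scope ring_scope.

(** * Inner product identities, the Cauchy-Schwarz inequality and continuity *)

Section InnerProduct.
Variables (R : realType) (V : innerProductType R).
Implicit Types (u v w : V) (a : R).

Lemma innerC u v : <|u, v|> = <|v, u|>.
Proof. by rewrite hermC expr0 mul1r. Qed.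

Lemma innerDl u v w : <|u + v, w|> = <|u, w|> + <|v, w|>.
Proof. exact: linearDl. Qed.

Lemma innerDr u v w : <|u, v + w|> = <|u, v|> + <|u, w|>.
Proof. exact: linearDr. Qed.
Lemma innerNl u w : <|- u, w|> = - <|u, w|>.
Proof. exact: linearNl. Qed.
Lemma innerNr u w : <|u, - w|> = - <|u, w|>.
Proof. exact: linearNr. Qed.
Lemma innerZl a u w : <|a *: u, w|> = a * <|u, w|>.
Proof. exact: linearZl_LR. Qed.
Lemma innerZr a u w : <|u, a *: w|> = a * <|u, w|>.
Proof. by rewrite innerC innerZl innerC. Qed.

Lemma inner0l w : <|0, w|> = 0. Proof. exact: linear0l. Qed.
Lemma inner0r w : <|w, 0|> = 0. Proof. exact: linear0r. Qed.

Definition innerE := (innerDl, innerDr, innerNl, innerNr, innerZl, innerZr).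

Lemma normD_sqr u v : `|u + v| ^+ 2 = `|u| ^+ 2 + 2 * <|u, v|> + `|v| ^+ 2.
Proof. by rewrite -!inner_norm !innerE (innerC v u); ring. Qed.

Lemma normB_sqr u v : `|u - v| ^+ 2 = `|u| ^+ 2 - 2 * <|u, v|> + `|v| ^+ 2.
Proof. by rewrite -!inner_norm !innerE (innerC v u); ring. Qed.

(** Expanding the nonnegative square of [|v| u - |u| v] leaves [2 |u| |v| (|u| |v| - <u, v>)]. *)
Lemma cauchy_schwarz u v : <|u, v|> <= `|u| * `|v|.
Proof.
have [->|v0] := eqVneq v 0; first by rewrite inner0r normr0 mulr0.
have v_gt0 : 0 < `|v| by rewrite normr_gt0.
have := sqr_ge0 `|(`|v| *: u - `|u| *: v)|.
rewrite normB_sqr !innerE !normrZ !normr_id => h.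
have [->|u0] := eqVneq u 0; first by rewrite inner0l normr0 mul0r.
have u_gt0 : 0 < `|u| by rewrite normr_gt0.
have uv_gt0 := mulr_gt0 u_gt0 v_gt0.
rewrite -(ler_pM2l uv_gt0); nra.
Qed.

Lemma normr_inner_le u v : `|<|u, v|>| <= `|u| * `|v|.
Proof.
by rewrite ler_norml lerNl -innerNl -[in X in X && _](normrN u) !cauchy_schwarz.
Qed.

Lemma inner_cvgl (u : nat -> V) l w :
  u n @[n --> \oo] --> l -> <|u n, w|> @[n --> \oo] --> <|l, w|>.
Proof.
move=> /cvgrPdist_lt ul; apply/cvgrPdist_lt => e e0.
have w0 : 0 < `|w| + 1 by rewrite ltr_wpDl.
have /ul : 0 < e / (`|w| + 1) by rewrite divr_gt0.
apply: filterS => n h; rewrite -innerNl -innerDl.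
apply: le_lt_trans (normr_inner_le _ _) _.
apply: (@le_lt_trans _ _ (`|l - u n| * (`|w| + 1))).
  by rewrite ler_wpM2l// lerDl.
by rewrite -ltr_pdivlMr.
Qed.

End InnerProduct.

(** * Coordinates, truncations and unit vectors of square-summable sequences *)

Section Sequences.
Variable R : realType.
Implicit Types (u v w : ell2 R).

Lemma ell2D u v k : (u + v) k = u k + v k. Proof. by []. Qed.
Lemma ell2N u k : (- u) k = - u k. Proof. by []. Qed.
Lemma ell2Z a u k : (a *: u) k = a * u k. Proof. by []. Qed.
Lemma ell2_0 k : (0 : ell2 R) k = 0. Proof. by []. Qed.
Definition ell2E := (ell2D, ell2N, ell2Z, ell2_0).

Lemma ell2_sum (I : Type) (r : seq I) (P : pred I) (F : I -> ell2 R) k :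
  (\sum_(i <- r | P i) F i) k = \sum_(i <- r | P i) F i k.
Proof. by apply: (big_morph (fun u : ell2 R => u k)). Qed.

Lemma ell2_inner_cvg u v : series (fun k => u k * v k) @ \oo --> <|u, v|>.
Proof. exact: ell2_dot_cvg. Qed.

Lemma ell2_inner_ge0 u v : (forall k, 0 <= u k * v k) -> 0 <= <|u, v|>.
Proof.
move=> uv; apply: limr_ge; first exact: ell2_dot_cvg.
by apply: nearW => n; rewrite /series/= sumr_ge0.
Qed.

Lemma sum_zero_tail (f : nat -> R) (N n : nat) : (N <= n)%N ->
  (forall k, (N <= k)%N -> f k = 0) -> \sum_(0 <= k < n) f k = \sum_(0 <= k < N) f k.
Proof.
move=> Nn fN; rewrite (big_cat_nat (n := N))//=.
rewrite [X in _ + X]big_nat_cond [X in _ + X]big1 ?addr0//.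
by move=> i /andP[/andP[/fN]].
Qed.

Definition finitely_supported (N : nat) u := forall k, (N <= k)%N -> u k = 0.

Lemma inner_finitely_supported N u v : finitely_supported N u ->
  <|u, v|> = \sum_(0 <= k < N) u k * v k.
Proof.
move=> uN; apply/cvg_lim => //; apply: cvg_near_cst.
exists N => // n /= Nn; rewrite /series/= (sum_zero_tail Nn)// => k /uN->.
by rewrite mul0r.
Qed.

Lemma ell2_le_norm u k : `|u k| <= `|u|.
Proof.
rewrite -ler_sqr ?nnegrE// -inner_norm real_normK ?num_real//.
apply: (@le_trans _ _ (series (fun i => u i * u i) k.+1)).
  rewrite /series/= big_nat_recr//= -expr2 lerDr sumr_ge0// => i _.
  by rewrite -expr2 sqr_ge0.
apply: nondecreasing_cvgn_le; last exact: ell2_dot_cvg.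
by apply: nondecreasing_series => i _ _; rewrite -expr2 sqr_ge0.
Qed.

(** The squares are the terms of a convergent series. This later puts all but finitely many dual
    coordinates strictly below [alpha]. *)
Lemma ell2_cvg0 u : u k @[k --> \oo] --> 0.
Proof.
have /cvg_series_cvg_0 := @ell2_dot_cvg _ u u.
move=> /cvgrPdist_lt h; apply/cvgrPdist_lt => e e0.
have /h : 0 < e ^+ 2 by rewrite exprn_gt0.
apply: filterS => k; rewrite !sub0r !normrN -expr2 normrX.
by rewrite ltr_pXn2r ?nnegrE// ltW.
Qed.

Lemma finitely_supported_summable N (f : nat -> R) :
  (forall k, (N <= k)%N -> f k = 0) -> f \in @square_summable R.
Proof.
move=> fN; apply/square_summableP; apply: (cvgP (series (fun k => f k ^+ 2) N)).
apply: cvg_near_cst; exists N => // n /= Nn; rewrite /series/= (sum_zero_tail Nn)// => k /fN->.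
by rewrite expr0n.
Qed.

Lemma truncate_subproof (f : nat -> R) (N k : nat) :
  (N <= k)%N -> (fun i => if (i < N)%N then f i else 0) k = 0.
Proof. by move=> Nk /=; rewrite ltnNge Nk. Qed.

(** Arbitrary sequences are allowed, so that the Riesz coefficients can be cut before they are known
    to be square-summable. *)
Definition truncate (N : nat) (f : nat -> R) : ell2 R :=
  Ell2 (finitely_supported_summable (@truncate_subproof f N)).

Lemma truncateE N f k : truncate N f k = if (k < N)%N then f k else 0.
Proof. by []. Qed.

Lemma finitely_supported_truncate N f : finitely_supported N (truncate N f).
Proof. exact: truncate_subproof. Qed.

Lemma truncate_id N u : finitely_supported N u -> truncate N u = u.
Proof.
by move=> uN; apply/val_inj/funext => k; rewrite [LHS]truncateE; case: ltnP => // /uN.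
Qed.

(** By orthogonality the squared error is [|u|^2 - |truncate N u|^2], and the subtracted term is a
    partial sum of the series for [|u|^2]. *)
Lemma truncate_cvg u : truncate N u @[N --> \oo] --> u.
Proof.
have h : `|u| ^+ 2 - `|truncate N u| ^+ 2 @[N --> \oo] --> (0 : R).
  rewrite -(subrr (`|u| ^+ 2)); apply: cvgB; first exact: cvg_cst.
  rewrite -inner_norm; apply: cvg_trans (@ell2_inner_cvg u u).
  apply: near_eq_cvg; apply: nearW => N.
  rewrite -inner_norm (inner_finitely_supported _ (@finitely_supported_truncate N u)).
  by rewrite /series/=; apply: eq_big_nat => i /andP[_ iN]; rewrite /= iN.
apply/cvgrPdist_lt => e e0; move/cvgrPdist_lt: h => /(_ (e ^+ 2)).
rewrite exprn_gt0// => /(_ isT); apply: filterS => N.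
rewrite sub0r normrN => /(le_lt_trans (ler_norm _)) h.
rewrite -ltr_sqr ?nnegrE ?(ltW e0)//; apply: le_lt_trans h.
rewrite normB_sqr -[X in 2 * X]innerC.
rewrite (_ : <|truncate N u, u|> = `|truncate N u| ^+ 2); first by lra.
rewrite -inner_norm !(inner_finitely_supported _ (@finitely_supported_truncate N u)).
by apply: eq_big_nat => i /andP[_ iN]; rewrite truncateE iN.
Qed.

Definition ell2_unit (k : nat) : ell2 R := truncate k.+1 (fun i => (i == k)%:R).

Lemma ell2_unitE k i : ell2_unit k i = (i == k)%:R.
Proof.
by rewrite truncateE ltnS; case: leqP => // ki; rewrite (gtn_eqF ki).
Qed.

Lemma truncate_sum N f :
  truncate N f = \sum_(0 <= k < N) f k *: ell2_unit k.
Proof.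
apply/val_inj/funext => i; rewrite [RHS]ell2_sum [LHS] truncateE; case: ifPn => iN.
  rewrite (bigD1_seq i) ?mem_iota ?iota_uniq ?subn0//.
  rewrite ell2Z ell2_unitE eqxx mulr1 big1 => [|j ji]; first exact/esym/addr0.
  by rewrite ell2Z ell2_unitE eq_sym (negbTE ji) mulr0.
rewrite big_nat_cond big1// => j /andP[/andP[_ jN] _].
rewrite ell2Z ell2_unitE; case: eqP => [ij|]; last by rewrite mulr0.
by rewrite ij jN in iN.
Qed.

Lemma inner_unit u k : <|u, ell2_unit k|> = u k.
Proof.
rewrite innerC (inner_finitely_supported _ (@finitely_supported_truncate k.+1 _)).
rewrite -/(ell2_unit k) big_nat_recr// ell2_unitE eqxx mul1r big_nat_cond.
rewrite big1 => [|i]; first exact: add0r.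
by move=> /andP[/andP[_ ik] _]; rewrite ell2_unitE (ltn_eqF ik) mul0r.
Qed.

End Sequences.

(** * Riesz representation and the adjoint of a bounded operator *)

Section Operator.
Variables (R : realType) (H : hilbertType R) (K : {linear ell2 R -> H}).
Hypothesis K_bounded : bounded_operator K.
Implicit Types (u v : ell2 R) (h : H).

Lemma bounded_operator_gt0 : exists2 C : R, 0 < C & forall u, `|K u| <= C * `|u|.
Proof.
have [C KC] := K_bounded; exists (Num.max C 1); first by rewrite lt_max ltr01 orbT.
by move=> u; apply: le_trans (KC u) _; rewrite ler_wpM2r// le_max lexx.
Qed.

Lemma bounded_operator_cvg (u : nat -> ell2 R) l :
  u n @[n --> \oo] --> l -> K (u n) @[n --> \oo] --> K l.
Proof.
have [C C0 KC] := bounded_operator_gt0.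
move=> /cvgrPdist_lt ul; apply/cvgrPdist_lt => e e0.
have /ul : 0 < e / C by rewrite divr_gt0.
apply: filterS => n h; rewrite -linearB/=; apply: le_lt_trans (KC _) _.
by rewrite mulrC -ltr_pdivlMr.
Qed.

Lemma inner_truncate (f : nat -> R) N h :
  <|K (truncate N f), h|> = \sum_(0 <= k < N) f k * <|K (ell2_unit R k), h|>.
Proof.
rewrite truncate_sum linear_sum/=.
rewrite (big_morph (fun w => <|w, h|>) (id1 := 0) (op1 := +%R)) ?inner0l//; last first.
  by move=> ? ?; rewrite innerDl.
by apply: eq_bigr => k _; rewrite linearZ/= innerZl.
Qed.

(** Testing the bound on [K] at the truncation [a_N] of the coefficients themselves gives
    [|a_N|^2 = <K a_N, h> <= C |h| |a_N|], which bounds the partial sums. *)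
Lemma riesz_summable h : (fun k => <|K (ell2_unit R k), h|>) \in @square_summable R.
Proof.
have [C C0 KC] := bounded_operator_gt0.
set a := fun k => _; apply/square_summableP.
apply: nondecreasing_is_cvgn; first by apply: nondecreasing_series => i _ _; rewrite sqr_ge0.
exists ((C * `|h|) ^+ 2) => _ [N _ <-].
have aE : series (fun k => a k ^+ 2) N = `|truncate N a| ^+ 2.
  rewrite -inner_norm (inner_finitely_supported _ (@finitely_supported_truncate _ N a)).
  by apply: eq_big_nat => i /andP[_ iN]; rewrite truncateE iN.
have : `|truncate N a| ^+ 2 <= C * `|h| * `|truncate N a|.
  rewrite mulrAC -aE; apply: le_trans (ler_wpM2r _ (KC _)) => //.
  apply: le_trans (cauchy_schwarz _ _); rewrite inner_truncate.
  by rewrite /series/=; under eq_bigr do rewrite expr2.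
rewrite aE; have := normr_ge0 (truncate N a); have := normr_ge0 h => h0 t0 th.
have Ch : 0 <= C * `|h| by rewrite mulr_ge0// ltW.
rewrite ler_sqr ?nnegrE//; have [->//|tn] := eqVneq `|truncate N a| 0.
have t_gt0 : 0 < `|truncate N a| by rewrite lt_neqAle eq_sym tn.
by rewrite -(ler_pM2r t_gt0) -expr2.
Qed.

Lemma riesz_representation h u : <|K u, h|> = <|u, Ell2 (riesz_summable h)|>.
Proof.
have := inner_cvgl (w := h) (bounded_operator_cvg (@truncate_cvg _ u)) => /cvg_lim <-//.
apply/cvg_lim => //; apply: cvg_trans (@ell2_inner_cvg _ _ _).
apply: near_eq_cvg; apply: nearW => N /=.
by rewrite inner_truncate.
Qed.

(** [adjoint] is picked by [get], which falls back to a default value when there is no candidate;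
    the Riesz vector is one. *)
Lemma adjointP h u : <|K u, h|> = <|u, adjoint K h|>.
Proof.
rewrite /adjoint; case: xgetP => [a -> //|/(_ _)].
by move=> /(_ (Ell2 (riesz_summable h)) (riesz_representation h)).
Qed.

Lemma adjoint_norm C h : (forall u, `|K u| <= C * `|u|) -> `|adjoint K h| <= C * `|h|.
Proof.
move=> KC; have [->|a0] := eqVneq (adjoint K h) 0.
  (* The sign of [C] is not given; testing its bound at a unit vector shows [0 <= C]. *)
  rewrite normr0 mulr_ge0//.
  have := KC (ell2_unit R 0); have : 0 < `|ell2_unit R 0|.
    by apply: lt_le_trans (ell2_le_norm _ 0); rewrite ell2_unitE eqxx normr1.
  by move=> e0 /(le_trans (normr_ge0 _)); rewrite pmulr_lge0.
have a_gt0 : 0 < `|adjoint K h| by rewrite normr_gt0.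
rewrite -(ler_pM2r a_gt0) -expr2 -inner_norm -adjointP.
by apply: le_trans (cauchy_schwarz _ _) _; rewrite mulrAC ler_wpM2r.
Qed.

Lemma ell2_innerP (a b : ell2 R) : (forall u, <|u, a|> = <|u, b|>) -> a = b.
Proof.
move=> ab; apply/val_inj/funext => k.
by rewrite -[LHS]inner_unit -[RHS]inner_unit !(innerC _ (ell2_unit R k)).
Qed.

Lemma adjointB h h' : adjoint K (h - h') = adjoint K h - adjoint K h'.
Proof. by apply: ell2_innerP => u; rewrite !innerE -!adjointP !innerE. Qed.

End Operator.

(** * Duality between the 1-norm and bounded sequences *)

Section Norm1.
Variable R : realType.
Implicit Types (p z : ell2 R) (alpha : R).

Lemma norm1Zl alpha z :
  (alpha%:E * norm1 z = \sum_(0 <= k <oo) (alpha * `|z k|)%:E)%E.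
Proof.
rewrite /norm1 -nneseriesZl// => k _; rewrite lee_fin.
Qed.

(** Holder's inequality on partial sums; if the right-hand side is [+oo], nothing is to be shown. *)
Lemma inner_le_norm1 alpha p z : 0 <= alpha -> (forall k, `|p k| <= alpha) ->
  (<|p, z|>%:E <= alpha%:E * norm1 z)%E.
Proof.
move=> alpha0 palpha; rewrite norm1Zl.
have ge0 k : (0 <= (alpha * `|z k|)%:E)%E by rewrite lee_fin mulr_ge0.
have part n : ((series (fun k => p k * z k) n)%:E <=
    \sum_(0 <= k <oo) (alpha * `|z k|)%:E)%E.
  apply: (@le_trans _ _ (\sum_(0 <= k < n) (alpha * `|z k|)%:E)%E).
    rewrite sumEFin lee_fin; apply: ler_sum => k _.
    by apply: le_trans (ler_norm _) _; rewrite normrM ler_wpM2r.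
  by apply: nneseries_lim_ge => k _.
case: (\sum_(_ <= _ <oo) _)%E part => [r part| |part]; last 2 first.
- by rewrite leey.
- by have := part 0%N; rewrite leeNy_eq.
- by rewrite lee_fin; apply: limr_le; [exact: ell2_dot_cvg|apply: nearW => n; rewrite -lee_fin].
Qed.

(** The equality case of the duality: the partial sums of the left-hand side are those of a
    convergent inner product. For [alpha > 0] this also shows that [norm1 z] is finite. *)
Lemma norm1_le_inner alpha p z : 0 <= alpha -> (forall k, p k * z k = alpha * `|z k|) ->
  (alpha%:E * norm1 z <= <|p, z|>%:E)%E.
Proof.
move=> alpha0 pz; rewrite norm1Zl.
apply: lime_le; first by apply: is_cvg_nneseries => k _ _; rewrite lee_fin mulr_ge0.
apply: nearW => n; rewrite sumEFin lee_fin; under eq_bigr do rewrite -pz.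
apply: (@nondecreasing_cvgn_le _ (series (fun k => p k * z k))).
  by apply: nondecreasing_series => k _ _; rewrite pz mulr_ge0.
exact: ell2_dot_cvg.
Qed.

End Norm1.

(** * Subgradients of the objective *)

Section Subgradient.
Variables (R : realType) (H : hilbertType R) (K : {linear ell2 R -> H}).
Variables (g : H) (alpha : R).
Hypothesis K_bounded : bounded_operator K.
Hypothesis alpha_gt0 : 0 < alpha.
Implicit Types (u v w y z p : ell2 R).

(** Membership of [x] in [alpha Sign(t)], the subdifferential of [alpha |.|] at [t], without a case
    split on the sign of [t]. *)
Definition sign_selection (x t : R) := `|x| <= alpha /\ x * t = alpha * `|t|.

Definition subgradient y v :=
  forall k, sign_selection ((v - adjoint K (K y - g)) k) (y k).

Lemma sign_selection_lt (x t : R) : sign_selection x t -> `|x| < alpha -> t = 0.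
Proof.
move=> [_ xt] x_lt; apply/eqP; rewrite -normr_eq0.
have : `|x| * `|t| = alpha * `|t| by rewrite -normrM xt normrM normr_id gtr0_norm.
move=> /eqP; rewrite -subr_eq0 -mulrBl mulf_eq0 subr_eq0 => /orP[/eqP xa|//].
by rewrite xa ltxx in x_lt.
Qed.

Lemma sign_selection_le (x s t : R) : `|x| <= alpha -> sign_selection s t -> x * t <= s * t.
Proof.
move=> x_le [_ ->]; apply: le_trans (ler_norm _) _.
by rewrite normrM ler_wpM2r.
Qed.

Lemma proj_sign_selection (x t : R) : sign_selection (proj_sign alpha t x) t.
Proof.
rewrite /sign_selection /proj_sign.
case: (ltrgt0P t) => [t0|t0|->] /=; rewrite ?mulr0 ?normr0 ?mulr0.
- by rewrite gtr0_norm// gtr0_norm.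
- by rewrite normrN gtr0_norm//; split=> //; rewrite mulNr mulrN.
- split=> //; case: ltP => [_|xa]; first by rewrite gtr0_norm.
  case: ltP => [_|ax]; first by rewrite normrN gtr0_norm.
  by rewrite ler_norml ax.
Qed.

(** By the definition of the residual, [v - adjoint K (K y - g)] is exactly the projected point,
    which lies in [alpha Sign(y)]. *)
Lemma accepted_subgradient sigma mu u y v :
  accepted K g alpha sigma mu u y v -> subgradient y v.
Proof.
move=> [eps [epsE -> _]] k.
have := congr1 (fun f : nat -> R => f k) epsE; rewrite /residual /=.
set x := (X in proj_sign _ _ X) => epsk; rewrite -/x in epsk.
have xE : x = - (adjoint K (K y - g)) k - mu * (y k - u k) by [].
set t := (X in sign_selection X _); suff -> : t = proj_sign alpha (y k) x.
  exact: proj_sign_selection.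
have aux (a m d e b q : R) : b = - a - m * d -> e = b - q -> - m * d - e - a = q.
  by move=> -> ->; ring.
exact: aux xE epsk.
Qed.

(** The functional [<p, .>] lies below [alpha norm1] and reaches it at [y]. Replacing the penalty by
    it leaves a quadratic whose excess at [z] is [|K (z - y)|^2 / 2]. *)
Lemma subgradient_minimizer y : subgradient y 0 -> is_minimizer (Psi K g alpha) y.
Proof.
rewrite /subgradient; set p := (0 - _) => py z; rewrite /Psi.
apply: (@le_trans _ _ ((2^-1 * `|K y - g| ^+ 2)%:E + <|p, y|>%:E)%E).
  by rewrite leeD2lE//; apply: norm1_le_inner => [|k]; [exact: ltW|exact: (py k).2].
apply: (@le_trans _ _ ((2^-1 * `|K z - g| ^+ 2)%:E + <|p, z|>%:E)%E); last first.
  by rewrite leeD2lE//; apply: inner_le_norm1 => [|k]; [exact: ltW|exact: (py k).1].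
rewrite -!EFinD lee_fin -subr_ge0.
rewrite (_ : K z - g = (K y - g) + K (z - y)); last by rewrite linearB/= [RHS]addrC addrA subrK.
rewrite normD_sqr innerC adjointP// (innerC p z) (innerC p y) /p !innerE !inner0r.
by have := sqr_ge0 `|K (z - y)|; lra.
Qed.

(** The [Sign] parts are monotone in each coordinate, and the gradients of the quadratic part
    contribute exactly [|K (y - z)|^2]. *)
Lemma subgradient_monotone y v z w : subgradient y v -> subgradient z w ->
  `|K (y - z)| ^+ 2 <= <|v - w, y - z|>.
Proof.
rewrite /subgradient; set p := v - _; set q := w - _ => py qz.
have : 0 <= <|p - q, y - z|>.
  apply: ell2_inner_ge0 => k; rewrite -[X in 0 <= X]/((p k - q k) * (y k - z k)).
  have := sign_selection_le (qz k).1 (py k); have := sign_selection_le (py k).1 (qz k).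
  by lra.
have -> : p - q = (v - w) - adjoint K (K (y - z)).
  rewrite (_ : K (y - z) = (K y - g) - (K z - g)).
    by rewrite adjointB// /p /q; apply/val_inj/funext => k /=;
      rewrite -[LHS]/(v k - (adjoint K (K y - g)) k - (w k - (adjoint K (K z - g)) k))
       -[RHS]/(v k - w k - ((adjoint K (K y - g)) k - (adjoint K (K z - g)) k)); ring.
  by rewrite linearB/= opprB addrA subrK.
by rewrite innerDl innerNl (innerC (adjoint _ _)) -adjointP// inner_norm subr_ge0.
Qed.

End Subgradient.

(** * FBI as a lower bound for [K] on finite sections *)

Section Coercivity.
Variables (R : realType) (H : hilbertType R) (K : {linear ell2 R -> H}).
Hypothesis K_FBI : finite_basis_injective K.
Implicit Types (u v w y z p : ell2 R).

(** Row vectors give access to matrix inversion and to the compactness of boxes. *)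
Definition of_rV N (x : 'rV[R]_N) : ell2 R :=
  truncate N (fun k => if insub k is Some j then x 0 j else 0).

Lemma of_rVE N (x : 'rV[R]_N) (i : 'I_N) : of_rV x i = x 0 i.
Proof. by rewrite truncateE ltn_ord valK. Qed.

Lemma finitely_supported_of_rV N (x : 'rV[R]_N) : finitely_supported N (of_rV x).
Proof. exact: finitely_supported_truncate. Qed.

Definition gram (N : nat) : 'M[R]_N :=
  \matrix_(i, j) <|K (ell2_unit R i), K (ell2_unit R j)|>.

Lemma row_mul_gram N (x : 'rV[R]_N) (z : ell2 R) :
  finitely_supported N z -> (forall i, x 0 i = z i) ->
  forall j, (x *m gram N) 0 j = <|K z, K (ell2_unit R j)|>.
Proof.
move=> zN xz j; rewrite mxE -(truncate_id zN) inner_truncate big_mkord.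
by apply: eq_bigr => i _; rewrite mxE xz.
Qed.

(** A row in the kernel yields [z] with [K z] orthogonal to the images of the first [N] unit
    vectors, hence to itself; FBI then makes [z] vanish. *)
Lemma gram_unit N : gram N \in unitmx.
Proof.
rewrite -row_free_unit -kermx_eq0; apply/eqP/row_matrixP => i; rewrite row0.
set x := row i _; have xG : x *m gram N = 0 by apply/sub_kermxP; rewrite row_sub.
pose z := of_rV x; have xz j : x 0 j = z j by rewrite of_rVE.
have zN : finitely_supported N z := finitely_supported_of_rV x.
have Kz0 : K z = 0.
  apply/eqP; rewrite -normr_eq0 -sqrf_eq0 -inner_norm -{1}(truncate_id zN) inner_truncate.
  rewrite big_mkord big1// => j _.
  by rewrite innerC -(row_mul_gram zN xz) xG mxE mulr0.
have z0 : z = 0.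
  apply: (K_FBI (finite_II N)); last by rewrite Kz0 linear0.
  by move=> k /= /negP; rewrite -leqNgt => /zN.
by apply/rowP => j; rewrite xz z0 mxE.
Qed.

(** The inverse Gram matrix recovers the coordinates of [z] from the inner products of [K z] with
    the images of the unit vectors, each at most a multiple of [|K z|]. *)
Lemma finite_basis_bounded_below N : exists2 C : R, 0 < C &
  forall z, finitely_supported N z -> `|z| <= C * `|K z|.
Proof.
pose G' := invmx (gram N).
pose B := \sum_(k < N) \sum_(j < N) `|K (ell2_unit R j)| * `|G' j k| * `|ell2_unit R k|.
(* The summand 1 makes the constant positive, also for [N = 0]. *)
exists (B + 1).
  by rewrite ltr_wpDl// sumr_ge0// => k _; rewrite sumr_ge0// => j _; rewrite !mulr_ge0.
move=> z zN; pose x : 'rV[R]_N := \row_i z i.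
have xz i : x 0 i = z i by rewrite mxE.
apply: (@le_trans _ _ (B * `|K z|)); last by rewrite ler_wpM2r// lerDl.
rewrite -{1}(truncate_id zN) truncate_sum big_mkord.
apply: le_trans (ler_norm_sum _ _ _) _; rewrite mulr_suml; apply: ler_sum => k _.
rewrite normrZ -xz -(mulmxK (gram_unit N) x) mxE -/G'.
apply: le_trans (ler_wpM2r (normr_ge0 _) (ler_norm_sum _ _ _)) _.
rewrite !mulr_suml; apply: ler_sum => j _.
rewrite [leRHS]mulrAC ler_wpM2r// normrM (row_mul_gram zN xz) [leRHS]mulrAC ler_wpM2r//.
by rewrite mulrC normr_inner_le.
Qed.

End Coercivity.

(** It suffices that [e N] is within [d] of the infimum of the sequence. *)
Lemma nonincreasing_gap (R : realType) (e : nat -> R) (d : R) :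
  (forall n, 0 <= e n) -> (forall n, e n.+1 <= e n) -> 0 < d ->
  exists N, forall n, (N <= n)%N -> e N - e n < d.
Proof.
move=> e0 e_dec d0.
have hi : has_inf (range e).
  by split; [exists (e 0%N), 0%N|exists 0 => _ [n _ <-]].
have [_ [N _ <-] eN] := inf_adherent d0 hi.
exists N => n _; rewrite ltrBlDr; apply: lt_le_trans eN _.
by rewrite addrC lerD2l; apply: ge_inf; [exact: hi.2|exists n].
Qed.

(** First-order optimality in one coordinate: the second-order term [c t^2] disappears when the
    direction is shrunk. Then the direction [p] gives the bound, and [s] and [- s] give the two
    halves of the equality. *)
Lemma sign_selection_variational (R : realType) (alpha c p s : R) : 0 <= c -> 0 <= alpha ->
  (forall t, p * t <= c * t ^+ 2 + alpha * (`|s + t| - `|s|)) ->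
  sign_selection alpha p s.
Proof.
move=> c0 alpha0 h.
have {h} h d : p * d <= alpha * (`|s + d| - `|s|).
  rewrite leNgt; apply/negP; rewrite -subr_gt0; set X := (X in 0 < X) => X0.
  have cd : 0 <= c * d ^+ 2 by rewrite mulr_ge0// sqr_ge0.
  (* The factor [t = X / D] is so small that [t c d^2 < t D = X], whereas convexity along [t d]
     gives [X <= t c d^2]. *)
  pose D := X + c * d ^+ 2 + 1; have D0 : 0 < D by rewrite /D; lra.
  have [t tD] : exists t, t * D = X by exists (X / D); rewrite divfK// gt_eqF.
  have t0 : 0 < t by rewrite -(pmulr_lgt0 _ D0) tD.
  have t1 : t < 1 by rewrite -(ltr_pM2r D0) tD mul1r /D; lra.
  have conv : `|s + t * d| <= (1 - t) * `|s| + t * `|s + d|.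
    rewrite (_ : s + t * d = (1 - t) * s + t * (s + d)); last by ring.
    apply: le_trans (ler_normD _ _) _.
    by rewrite !normrM (gtr0_norm t0) gtr0_norm// subr_gt0.
  have := h (t * d); have := ler_wpM2l alpha0 conv => h1 h2.
  have : t * X <= t * (t * (c * d ^+ 2)).
    rewrite /X; move: h1 h2; set a := `|s|; set b := `|s + d|; set e := `|_|; nra.
  rewrite ler_pM2l// => h3.
  have : t * (c * d ^+ 2) < X by rewrite -[ltRHS]tD ltr_pM2l// /D; lra.
  by rewrite ltNge h3.
split.
  have hp : p * p <= alpha * `|p|.
    apply: le_trans (h p) _; rewrite ler_wpM2l//.
    by have := ler_normD s p; lra.
  rewrite leNgt; apply/negP => ap.
  by have pp : `|p| * `|p| = p * p by [rewrite -normrM ger0_norm// -expr2 sqr_ge0]; nra.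
apply/eqP; rewrite eq_le; apply/andP; split.
  apply: le_trans (h s) _; rewrite ler_wpM2l//.
  by have := ler_normD s s; lra.
by have := h (- s); rewrite subrr normr0; lra.
Qed.

(** * Existence of a minimizer, and the error bound *)

Section Existence.
Variables (R : realType) (H : hilbertType R) (K : {linear ell2 R -> H}).
Variables (g : H) (alpha : R).
Hypothesis K_bounded : bounded_operator K.
Hypothesis alpha_gt0 : 0 < alpha.
Implicit Types (u v w y z p : ell2 R).

(** Cutting the 1-norm keeps the values real; on vectors supported below [N] it agrees with
    [Psi]. *)
Definition section_objective N u :=
  2^-1 * `|K u - g| ^+ 2 + alpha * \sum_(0 <= k < N) `|u k|.

Lemma section_objective_ge0 N u : 0 <= section_objective N u.
Proof.
rewrite addr_ge0// mulr_ge0// ?sqr_ge0// ?sumr_ge0//; exact: ltW.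
Qed.

Lemma section_objective_continuous N :
  continuous (fun x : 'rV[R]_N => section_objective N (of_rV x)).
Proof.
rewrite (_ : (fun x => _) = fun x : 'rV[R]_N =>
  2^-1 * `|\sum_(i < N) x 0 i *: K (ell2_unit R i) - g| ^+ 2 +
  alpha * \sum_(i < N) `|x 0 i|); last first.
  apply/funext => x; rewrite /section_objective big_mkord.
  rewrite -{1}(truncate_id (finitely_supported_of_rV x)) truncate_sum linear_sum big_mkord.
  congr (_ * `|_ - _| ^+ 2 + _ * _); apply: eq_bigr => i _; last by rewrite of_rVE.
  by rewrite linearZ of_rVE.
suff lim (T : Type) (F : set_system T) (c : 'I_N -> T -> R) (l : 'I_N -> R) : Filter F ->
    (forall i, c i t @[t --> F] --> l i) ->
    2^-1 * `|\sum_(i < N) c i t *: K (ell2_unit R i) - g| ^+ 2 +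
      alpha * \sum_(i < N) `|c i t| @[t --> F] -->
    2^-1 * `|\sum_(i < N) l i *: K (ell2_unit R i) - g| ^+ 2 +
      alpha * \sum_(i < N) `|l i|.
  move=> x; refine (lim 'rV[R]_N (nbhs x) (fun i (t : 'rV[R]_N) => t 0 i)
    (fun i => x 0 i) (nbhs_filter x) _) => i.
  exact: coord_continuous.
move=> FF Fx; apply: cvgD; apply: cvgMl_tmp.
  suff h : `|\sum_(i < N) c i t *: K (ell2_unit R i) - g| @[t --> F] -->
      `|\sum_(i < N) l i *: K (ell2_unit R i) - g| by exact: (cvgM h h).
  apply: cvg_norm; apply: cvgB; last exact: cvg_cst.
  apply: cvg_big => [|i _]; first exact: add_continuous.
  exact: cvgZr_tmp.
apply: cvg_big => [|i _]; first exact: add_continuous.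
exact: cvg_norm.
Qed.

Lemma section_minimizer_exists N : exists u, finitely_supported N u /\
  forall z, finitely_supported N z -> section_objective N u <= section_objective N z.
Proof.
(* If one coordinate exceeds [b] in absolute value, the penalty alone exceeds the value at 0; so it
   suffices to minimize over a box. *)
pose b := section_objective N 0 / alpha.
have b0 : 0 <= b by rewrite divr_ge0// ?section_objective_ge0// ltW.
pose A := [set x : 'rV[R]_N | forall i, `[- b, b]%classic (x ord0 i)].
have cA : compact A.
  apply: (@rV_compact _ _ (fun=> `[- b, b]%classic)) => _.
  exact: segment_compact.
have A0 : A !=set0 by exists 0 => i /=; rewrite mxE in_itv/= oppr_le0 b0.
have [c _ cmin] := EVT_min_rV A0 cA
  (continuous_subspaceT (@section_objective_continuous N)).
exists (of_rV c); split; first exact: finitely_supported_of_rV.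
move=> z zN; pose x : 'rV[R]_N := \row_i z i.
have zE : z = of_rV x.
  apply/val_inj/funext => k; case: (ltnP k N) => kN; last first.
    by rewrite [LHS]zN// [RHS]finitely_supported_of_rV.
  by rewrite [RHS](of_rVE x (Ordinal kN)) mxE.
have [xA|] := pselect (A x); first by rewrite zE; apply: cmin; rewrite inE.
move=> /existsNP[i]; rewrite /= in_itv/= mxE -ler_norml => /negP; rewrite -ltNge => zi.
apply: (@le_trans _ _ (section_objective N 0)).
  have -> : 0 = of_rV (0 : 'rV[R]_N).
    apply/val_inj/funext => k; case: (ltnP k N) => kN; last first.
      by rewrite [RHS]finitely_supported_of_rV.
    by rewrite [RHS](of_rVE 0 (Ordinal kN)) mxE.
  by apply: cmin; rewrite inE => j /=; rewrite mxE in_itv/= oppr_le0 b0.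
apply: (@le_trans _ _ (alpha * `|z i|)).
  by rewrite mulrC -ler_pdivrMr// ltW.
rewrite /section_objective big_mkord (bigD1 i)//=.
by rewrite mulrDr addrCA lerDl addr_ge0// mulr_ge0// ?sqr_ge0// ?sumr_ge0//; exact: ltW.
Qed.

Lemma section_minimizer_selection N u : finitely_supported N u ->
  (forall z, finitely_supported N z -> section_objective N u <= section_objective N z) ->
  forall k, (k < N)%N -> sign_selection alpha ((- adjoint K (K u - g)) k) (u k).
Proof.
move=> uN umin k kN.
apply: (@sign_selection_variational _ _ (2^-1 * `|K (ell2_unit R k)| ^+ 2)).
- by rewrite mulr_ge0// sqr_ge0.
- exact: ltW.
move=> t; have zN : finitely_supported N (u + t *: ell2_unit R k).
  move=> i Ni; rewrite ell2D ell2Z uN// ell2_unitE gtn_eqF ?mulr0 ?addr0//.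
  exact: leq_trans Ni.
have Kz : K (u + t *: ell2_unit R k) = K u + t *: K (ell2_unit R k).
  by rewrite linearD linearZ.
have := umin _ zN; rewrite /section_objective Kz addrAC (normD_sqr (K u - g)).
rewrite innerZr innerC adjointP// (innerC (ell2_unit R k)) inner_unit.
rewrite normrZ exprMn real_normK ?num_real//.
have split w : \sum_(0 <= i < N) `|w i| = `|w k| + \sum_(0 <= i < N | i != k) `|w i|.
  by rewrite (bigD1_seq k) ?mem_iota ?iota_uniq ?subn0.
rewrite !split ell2D ell2Z ell2_unitE eqxx mulr1 ell2N.
have -> : \sum_(0 <= i < N | i != k) `|(u + t *: ell2_unit R k) i| =
    \sum_(0 <= i < N | i != k) `|u i|.
  by apply: eq_bigr => i ik; rewrite ell2D ell2Z ell2_unitE (negbTE ik) mulr0 addr0.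
by lra.
Qed.

(** The sign selection absorbs the linear term of the expansion at [u], and the second-order term
    remains as a gain. It will control the images [K (u N)] of the section minimizers. *)
Lemma section_objective_growth N u z :
  (forall k, (k < N)%N -> sign_selection alpha ((- adjoint K (K u - g)) k) (u k)) ->
  finitely_supported N u -> finitely_supported N z ->
  section_objective N u + 2^-1 * `|K (z - u)| ^+ 2 <= section_objective N z.
Proof.
set p := - adjoint K _ => pu uN zN.
have zuN : finitely_supported N (z - u) by move=> k Nk; rewrite ell2D ell2N uN// zN// subr0.
have : \sum_(0 <= k < N) p k * (z k - u k) <=
    alpha * \sum_(0 <= k < N) `|z k| - alpha * \sum_(0 <= k < N) `|u k|.
  rewrite !mulr_sumr -sumrB; apply: ler_sum_nat => k /andP[_ /pu[pa pE]].
  rewrite mulrBr pE lerD2r; apply: le_trans (ler_norm _) _.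
  by rewrite normrM ler_wpM2r.
have : <|K u - g, K (z - u)|> = - \sum_(0 <= k < N) p k * (z k - u k).
  rewrite innerC adjointP// -sumrN (inner_finitely_supported _ zuN).
  by apply: eq_bigr => k _; rewrite /p !ell2E; ring.
rewrite /section_objective (_ : K z - g = (K u - g) + K (z - u)).
  by rewrite (normD_sqr (K u - g)) => ->; lra.
by rewrite linearB/= [RHS]addrC addrA subrK.
Qed.

(* The section minimizers [u N] have [K (u N)] Cauchy, since the objective
   decreases in [N]; so the dual vectors [- K^* (K (u N) - g)] are eventually
   close to a fixed element of ell2, hence below [alpha] beyond a fixed index,
   and the supports stop growing. *)
Lemma subgradient0_exists : exists u, subgradient K g alpha u 0.
Proof.
have [u uP] := choice section_minimizer_exists.
pose p N := - adjoint K (K (u N) - g).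
have sel N := section_minimizer_selection (uP N).1 (uP N).2.
pose e N := section_objective N (u N).
(* [u N] competes in the larger section [M], where its objective value is unchanged. *)
have grow N M : (N <= M)%N -> e M + 2^-1 * `|K (u N - u M)| ^+ 2 <= e N.
  move=> NM; rewrite [leRHS](_ : _ = section_objective M (u N)).
    apply: section_objective_growth (sel M) (uP M).1 _ => k Mk.
    by apply: (uP N).1; exact: leq_trans Mk.
  rewrite /e /section_objective; congr (_ + _ * _); symmetry.
  by apply: (sum_zero_tail NM) => k /(uP N).1 ->; rewrite normr0.
have e_dec N : e N.+1 <= e N.
  by apply: le_trans (grow N N.+1 (leqnSn _)); rewrite lerDl mulr_ge0// sqr_ge0.
have [C C0 KC] := bounded_operator_gt0 K_bounded.
(* Thus [C d = alpha / 2]; the other half of [alpha] is left for the tail of [p N0]. *)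
pose d := alpha / (2 * C).
have d0 : 0 < d by rewrite divr_gt0// mulr_gt0.
have [N0 N0P] : exists N, forall n, (N <= n)%N -> e N - e n < 2^-1 * d ^+ 2.
  apply: nonincreasing_gap => // [n|]; first exact: section_objective_ge0.
  by rewrite mulr_gt0// exprn_gt0.
have close M k : (N0 <= M)%N -> `|p M k| < alpha / 2 + `|p N0 k|.
  move=> NM; have Kd : `|K (u N0 - u M)| < d.
    rewrite -ltr_sqr ?nnegrE// ?(ltW d0)//.
    by have := grow _ _ NM; have := N0P _ NM; lra.
  have pd : p M - p N0 = adjoint K (K (u N0 - u M)).
    rewrite /p opprK addrC -adjointB//; congr (adjoint K _).
    by rewrite [RHS]linearB/= opprB addrA subrK.
  have := ell2_le_norm (p M - p N0) k; rewrite {2}pd.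
  move=> /le_trans /(_ (adjoint_norm K_bounded _ KC)) h.
  rewrite -ltrBlDr; apply: le_lt_trans (lerB_dist _ _) _.
  apply: le_lt_trans h _; rewrite -ltr_pdivlMl//.
  by rewrite (_ : C^-1 * (alpha / 2) = d)// /d invfM; ring.
have [N1 _ N1P] : \forall k \near \oo, `|p N0 k| < alpha / 2.
  have /cvgrPdist_lt /(_ (alpha / 2)) := @ell2_cvg0 _ (p N0).
  by rewrite divr_gt0// => /(_ isT); apply: filterS => k; rewrite sub0r normrN.
(* Below [N] this is optimality in the section; from [N] on [u N] vanishes, and only
   [|p N k| <= alpha] has to be checked. *)
pose N := maxn N0 N1; exists (u N) => k; rewrite sub0r.
have [kN|Nk] := ltnP k N; first exact: sel.
rewrite (uP N).1//; split; last by rewrite mulr0 normr0 mulr0.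
apply: ltW; apply: lt_trans (close N k (leq_maxl _ _)) _.
by have := N1P k (leq_trans (leq_maxr _ _) Nk); rewrite /=; lra.
Qed.

Hypothesis K_FBI : finite_basis_injective K.

(** Monotonicity gives [|K (y - ub)|^2 <= |v| |y - ub|]. This is used twice: first to make
    [K (y - ub)] small, which confines the support of [y], then with the lower bound on that
    support, which gives [kappa = D^2]. *)
Lemma subgradient_error_bound ub B : subgradient K g alpha ub 0 -> 0 <= B ->
  exists d kappa : R, [/\ 0 < d, 0 < kappa & forall y v, subgradient K g alpha y v ->
    `|y - ub| <= B -> `|v| <= d -> `|y - ub| <= kappa * `|v|].
Proof.
move=> sub B0; have [C C0 KC] := bounded_operator_gt0 K_bounded.
pose q : ell2 R := 0 - adjoint K (K ub - g).
have [N _ NP] : \forall k \near \oo, `|q k| < alpha / 2.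
  have /cvgrPdist_lt /(_ (alpha / 2)) := @ell2_cvg0 _ q.
  by rewrite divr_gt0// => /(_ isT); apply: filterS => k; rewrite sub0r normrN.
have [D D0 KD] := finite_basis_bounded_below K_FBI N.
(* The budget for [|p k| < alpha]: [alpha / 2] for [q], [alpha / 4] for [v], and [C r = alpha / 4]
   for the adjoint of [K (y - ub)]. *)
pose r := alpha / (4 * C); have r0 : 0 < r by rewrite divr_gt0// mulr_gt0.
have Cr : C * r = alpha / 4 by rewrite /r; field; rewrite gt_eqF.
have B1 : 0 < B + 1 by rewrite ltr_wpDl.
(* The second entry ensures [d B < r^2]; [B + 1] avoids a division by 0. *)
pose d := Num.min (alpha / 4) (r ^+ 2 / (B + 1)).
have d0 : 0 < d by rewrite lt_min divr_gt0//= divr_gt0// exprn_gt0.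
have dB : d * B < r ^+ 2.
  apply: (@lt_le_trans _ _ (d * (B + 1))); first by rewrite ltr_pM2l// ltrDl.
  by rewrite -ler_pdivlMr// /d ge_min lexx orbT.
exists d, (D ^+ 2); split => //; first by rewrite exprn_gt0.
move=> y v suby yB vd; pose p := v - adjoint K (K y - g).
have mono := subgradient_monotone K_bounded suby sub.
rewrite subr0 in mono; have {}mono := le_trans mono (cauchy_schwarz _ _).
have Kr : `|K (y - ub)| < r.
  rewrite -ltr_sqr ?nnegrE// ?(ltW r0)//; apply: le_lt_trans mono _.
  by apply: le_lt_trans dB; apply: ler_pM.
have supp_ub : finitely_supported N ub.
  move=> k Nk; apply: sign_selection_lt (sub k) _ => //.
  by apply: lt_trans (NP k Nk) _; rewrite ltr_pdivrMr// ltr_pMr// ltr1n.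
have supp_y : finitely_supported N y.
  move=> k Nk; apply: sign_selection_lt (suby k) _ => //; rewrite -/p.
  have pq : p - q = v - adjoint K (K (y - ub)).
    rewrite (_ : K (y - ub) = (K y - g) - (K ub - g)).
      by rewrite adjointB// /p /q sub0r !opprB opprK addrA addrAC.
    by rewrite [LHS]linearB/= opprB addrA subrK.
  have := ell2_le_norm (p - q) k; rewrite {2}pq => h.
  have h1 : `|p k| <= `|q k| + `|(p - q) k|.
    by rewrite -[X in `|X|](subrK (q k)) addrC; exact: ler_normD.
  have h2 := ler_normB v (adjoint K (K (y - ub))).
  have h3 := adjoint_norm K_bounded (K (y - ub)) KC.
  have h4 : C * `|K (y - ub)| < alpha / 4 by rewrite -Cr ltr_pM2l.
  have h5 : `|v| <= alpha / 4 by apply: le_trans vd _; rewrite /d ge_min lexx.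
  have := NP k Nk; rewrite /=; lra.
have supp_z : finitely_supported N (y - ub).
  by move=> k Nk; rewrite ell2D ell2N supp_y// supp_ub// subr0.
have [->|z0] := eqVneq (y - ub) 0; first by rewrite normr0 mulr_ge0// ltW// exprn_gt0.
have z_gt0 : 0 < `|y - ub| by rewrite normr_gt0.
rewrite -(ler_pM2r z_gt0) -expr2 -mulrA.
apply: le_trans (ler_wpM2l (sqr_ge0 D) mono).
by rewrite -exprMn ler_sqr ?nnegrE ?mulr_ge0 ?(ltW D0)//; exact: KD.
Qed.

End Existence.

(** * Projection onto a separating hyperplane, and linear convergence of Fejer monotone sequences *)

Section ProjectionStep.
Variables (R : realType) (V : innerProductType R).
Implicit Types (u v y l : V) (sigma mu : R).

(** With [a = mu (u - y)] one has [eps = a - v]; expand [|a - v|^2 <= sigma^2 m^2] and use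
    [m^2 <= |a|^2 + |v|^2]. *)
Lemma relative_error_inner sigma mu u y v (eps : V) : 0 <= sigma -> 0 < mu ->
  v = - mu *: (y - u) - eps -> `|eps| <= sigma * Num.max `|v| (mu * `|y - u|) ->
  (1 - sigma ^+ 2) / 2 * Num.max `|v| (mu * `|y - u|) ^+ 2 <= mu * <|v, u - y|>.
Proof.
move=> s0 mu0 vE; set m := Num.max _ _ => epsm.
pose a := mu *: (u - y).
have aE : `|a| = mu * `|y - u| by rewrite normrZ gtr0_norm// distrC.
have epsE : eps = a - v by rewrite vE /a scaleNr -scalerN !opprB addrCA subrr addr0.
have m0 : 0 <= m by rewrite le_max normr_ge0.
have : `|eps| ^+ 2 <= sigma ^+ 2 * m ^+ 2.
  by rewrite -exprMn ler_sqr ?nnegrE// mulr_ge0.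
have : m ^+ 2 <= `|a| ^+ 2 + `|v| ^+ 2.
  rewrite /m -aE; have := sqr_ge0 `|a|; have := sqr_ge0 `|v|.
  by rewrite maxEle; case: ifP => _; lra.
rewrite epsE normB_sqr (innerC a) /a innerZr; lra.
Qed.

(** For the step length [t], [<v, u - l> >= <v, u - y> = t |v|^2], so the expanded square drops by
    at least [t^2 |v|^2]. *)
Lemma projection_step u v y l : v != 0 -> 0 <= <|v, u - y|> -> 0 <= <|v, y - l|> ->
  `|u - (<|v, u - y|> / `|v| ^+ 2) *: v - l| ^+ 2 <=
  `|u - l| ^+ 2 - (<|v, u - y|> / `|v|) ^+ 2.
Proof.
move=> v0 vuy vyl; have v_gt0 : 0 < `|v| by rewrite normr_gt0.
set t := _ / _; have t0 : 0 <= t by rewrite divr_ge0// sqr_ge0.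
have tv : <|v, u - y|> = t * `|v| ^+ 2 by rewrite divfK// expf_neq0// gt_eqF.
rewrite (addrAC u) (normB_sqr (u - l)) innerZr normrZ exprMn real_normK ?num_real//.
have -> : <|v, u - y|> / `|v| = t * `|v| by rewrite tv; field; rewrite gt_eqF.
have -> : <|u - l, v|> = <|v, u - y|> + <|v, y - l|>.
  by rewrite innerC -innerDr addrA subrK.
have : t * <|v, u - y|> = t ^+ 2 * `|v| ^+ 2 by rewrite tv mulrA -expr2.
by have := mulr_ge0 t0 vyl; rewrite (exprMn 2 t); lra.
Qed.

End ProjectionStep.

Lemma Q_linearly_cvg (R : realType) (V : normedModType R) (u : V ^nat) (l : V) :
  Q_linearly u l -> u @ \oo --> l.
Proof.
move=> [q /andP[q0 q1] [N _ NP]].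
have h k : `|u (k + N)%N - l| <= geometric `|u N - l| q k.
  elim: k => [|k IH]; first by rewrite /geometric/= expr0 mulr1.
  apply: le_trans (NP _ (leq_addl _ _)) _.
  by apply: le_trans (ler_wpM2l q0 IH) _; rewrite /geometric/= exprS mulrCA.
rewrite -(cvg_shiftn N); apply/cvgrPdist_lt => e e0.
have /cvgrPdist_lt/(_ e e0) : geometric `|u N - l| q @ \oo --> (0 : R).
  by apply: cvg_geometric; rewrite ger0_norm.
apply: filterS => k; rewrite sub0r normrN => /(le_lt_trans (ler_norm _)).
by move=> ke; rewrite distrC; exact: le_lt_trans (h k) ke.
Qed.

(* Along a sequence that is Fejer monotone with gain [th * rho], the gains tend
   to 0, so the error bound [`|u n - l| <= L * rho] eventually applies and turns
   the gain into a contraction. *)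
Lemma fejer_Q_linearly (R : realType) (V : normedModType R) (u : V ^nat) (l : V)
    (th r L : R) : 0 < th -> 0 < r -> 0 < L ->
  (forall n, exists rho, [/\ 0 <= rho,
    `|u n.+1 - l| ^+ 2 <= `|u n - l| ^+ 2 - (th * rho) ^+ 2 &
    rho <= r -> `|u n - l| <= `|u 0%N - l| -> `|u n - l| <= L * rho]) ->
  Q_linearly u l.
Proof.
move=> th0 r0 L0 fejer; pose e n := `|u n - l| ^+ 2.
have e_dec n : e n.+1 <= e n.
  by have [rho [_ h _]] := fejer n; apply: le_trans h _; rewrite gerBl sqr_ge0.
have e_decn n m : (n <= m)%N -> e m <= e n.
  by apply/nonincreasing_seqP: n m.
have u_dec n : `|u n - l| <= `|u 0%N - l|.
  by rewrite -ler_sqr ?nnegrE//; exact: e_decn.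
have [N NP] : exists N, forall n, (N <= n)%N -> e N - e n < (th * r) ^+ 2.
  apply: nonincreasing_gap => // [n|]; first exact: sqr_ge0.
  by rewrite exprn_gt0// mulr_gt0.
(* The choice gives [c |u n - l| <= th rho], so [1 - c^2] bounds the squared ratio; the cap 1 keeps
   it nonnegative. *)
pose c := Num.min 1 (th / L).
have c0 : 0 < c by rewrite lt_min ltr01 divr_gt0.
have c21 : 0 <= 1 - c ^+ 2 by rewrite subr_ge0 expr_le1 ?ge_min ?lexx// ltW.
exists (Num.sqrt (1 - c ^+ 2)).
  by rewrite sqrtr_ge0/= -[X in _ < X]sqrtr1 ltr_sqrt// gtrBl exprn_gt0.
exists N => // n /= Nn; have [rho [rho0 u_rho L_rho]] := fejer n.
(* The single gain [(th rho)^2] is at most the decrease of [e] from [N] to [n.+1], which is below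
   [(th r)^2]. *)
have rho_r : rho < r.
  rewrite -(ltr_pM2l th0) -ltr_sqr ?nnegrE ?mulr_ge0 ?(ltW th0) ?(ltW r0)//.
  have := NP n.+1 (leqW Nn); apply: le_lt_trans.
  by have := e_decn _ _ Nn; move: u_rho; rewrite /e; lra.
have cu : c * `|u n - l| <= th * rho.
  apply: (@le_trans _ _ (th / L * (L * rho))).
    apply: ler_pM => //; [exact: ltW|by rewrite ge_min lexx orbT|].
    by apply: L_rho => //; exact: ltW.
  by rewrite mulrA divfK// gt_eqF.
rewrite -ler_sqr ?nnegrE ?mulr_ge0 ?sqrtr_ge0// exprMn sqr_sqrtr//.
apply: le_trans u_rho _; rewrite mulrBl mul1r lerD2l lerN2 -exprMn.
by rewrite ler_sqr ?nnegrE ?mulr_ge0// ltW.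
Qed.

(** * Stopping and descent in the outer steps of the algorithm *)

Section Algorithm.
Variables (R : realType) (H : hilbertType R) (K : {linear ell2 R -> H}).
Variables (g : H) (alpha smin smax sigma : R).
Hypothesis K_bounded : bounded_operator K.
Hypothesis alpha_gt0 : 0 < alpha.
Hypothesis sigma_ge0_lt1 : 0 <= sigma < 1.
Implicit Types (mu : R ^nat) (u y v : (ell2 R) ^nat).

Lemma outer_step_accepted mu u y v n :
  outer_step K g alpha smin smax sigma mu u y v n ->
  0 < mu n /\ accepted K g alpha sigma (mu n) (u n) (y n) (v n).
Proof. by move=> [? [? [? []]]]. Qed.

Lemma outer_step_inner mu u y v n :
  outer_step K g alpha smin smax sigma mu u y v n ->
  (1 - sigma ^+ 2) / 2 * Num.max `|v n| (mu n * `|y n - u n|) ^+ 2 <=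
  mu n * <|v n, u n - y n|>.
Proof.
move=> /outer_step_accepted[mu0 [eps [_ vE epsv]]].
by apply: relative_error_inner vE epsv => //; case/andP: sigma_ge0_lt1.
Qed.

Lemma theta_gt0 : 0 < (1 - sigma ^+ 2) / 2.
Proof.
case/andP: sigma_ge0_lt1 => s0 s1.
by rewrite divr_gt0// subr_gt0 expr_lt1.
Qed.

(** Either stopping test makes [<v, u - y>] vanish, and then the error test forces both [v = 0] and
    [y = u]. *)
Lemma stopped_subgradient mu u y v N :
  outer_step K g alpha smin smax sigma mu u y v N -> stops u y v N ->
  subgradient K g alpha (u N) 0.
Proof.
move=> step st; have := outer_step_inner step.
have -> : <|v N, u N - y N|> = 0.
  by case: st => ->; rewrite ?inner0l// subrr inner0r.
rewrite mulr0 pmulr_rle0 ?theta_gt0//; set m := Num.max _ _ => m2.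
have [mu0 /(accepted_subgradient alpha_gt0) sub] := outer_step_accepted step.
have m0 : m = 0 by apply/eqP; rewrite -sqrf_eq0 eq_le m2 sqr_ge0.
have v0 : v N = 0 by apply/eqP; rewrite -normr_le0 -m0 le_max lexx.
have yu : y N = u N.
  apply/eqP; rewrite -subr_eq0 -normr_le0 -(pmulr_rle0 _ mu0) -m0.
  by rewrite le_max lexx orbT.
by rewrite -v0 -yu.
Qed.

Lemma advances_fejer mu u y v n ub : subgradient K g alpha ub 0 ->
  advances K g alpha smin smax sigma mu u y v n ->
  exists rho : R, [/\ `|v n| <= mu n * rho, `|y n - u n| <= rho &
    `|u n.+1 - ub| ^+ 2 <= `|u n - ub| ^+ 2 - ((1 - sigma ^+ 2) / 2 * rho) ^+ 2].
Proof.
move=> sub [step st ->]; have := outer_step_inner step.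
have [mu0 /(accepted_subgradient alpha_gt0) suby] := outer_step_accepted step.
set m := Num.max _ _; set th := _ / 2 => vm.
have th0 : 0 < th := theta_gt0.
have v0 : v n != 0 by apply/eqP => v0; apply: st; left.
have v_gt0 : 0 < `|v n| by rewrite normr_gt0.
have vm_le : `|v n| <= m by rewrite le_max lexx.
have m0 : 0 < m by apply: lt_le_trans vm_le.
have vyl : 0 <= <|v n, y n - ub|>.
  have := subgradient_monotone K_bounded suby sub.
  by rewrite subr0; apply: le_trans; exact: sqr_ge0.
have vuy : th * m * (m / mu n) <= <|v n, u n - y n|>.
  by rewrite mulrA ler_pdivrMr// [leRHS]mulrC -mulrA -expr2.
(* For this [rho], [<v, u - y> >= th m rho]; dividing by [|v| <= m] gives the gain [th rho]. *)
exists (m / mu n); split.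
- by rewrite mulrCA divff ?gt_eqF// mulr1.
- by rewrite ler_pdivlMr// mulrC le_max lexx orbT.
have r0 : 0 < m / mu n by rewrite divr_gt0.
have vuy0 : 0 <= <|v n, u n - y n|>.
  by apply: le_trans vuy; rewrite mulr_ge0 ?(ltW r0)// mulr_ge0// ltW.
apply: le_trans (projection_step v0 vuy0 vyl) _.
rewrite lerD2l lerN2 ler_sqr ?nnegrE; last 2 first.
- by rewrite mulr_ge0// ltW.
- by rewrite divr_ge0.
rewrite ler_pdivlMr//; apply: le_trans vuy.
by rewrite mulrAC ler_pM2r// ler_pM2l.
Qed.

End Algorithm.

Theorem theorem4p3 (R : realType) (H : hilbertType R)
    (K : {linear ell2 R -> H}) (g : H) (alpha smin smax sigma : R)
    (K_bounded : bounded_operator K) (K_FBI : finite_basis_injective K)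
    (alpha_gt0 : 0 < alpha) (sigma_ge0_lt1 : 0 <= sigma < 1)
    (smin_gt0 : 0 < smin) (smax_lt : smax < 2 / opnorm K ^+ 2)
    (mu : R ^nat) (u y v : (ell2 R) ^nat) :
  (infinite_run K g alpha smin smax sigma mu u y v ->
     (exists M : R, forall n, mu n <= M) ->
     exists ubar : ell2 R,
       [/\ is_minimizer (Psi K g alpha) ubar,
           u @ \oo --> ubar &
           Q_linearly u ubar]) /\
  (forall N : nat, stopped_run K g alpha smin smax sigma mu u y v N ->
     is_minimizer (Psi K g alpha) (u N)).
Proof.
split; last first.
  move=> N [_ step st]; apply: subgradient_minimizer => //.
  exact: stopped_subgradient step st.
move=> run [M0 muM0].
have [ub sub] := subgradient0_exists g K_bounded alpha_gt0.
suff ql : Q_linearly u ub.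
  exists ub; split => //; first exact: subgradient_minimizer.
  exact: Q_linearly_cvg.
pose M := Num.max M0 1.
have M_gt0 : 0 < M by rewrite lt_max ltr01 orbT.
(* This radius will contain [y n]: [|y n - u n| <= rho <= 1], and [u n] is no farther from [ub] than
   [u 0]. *)
have B0 : 0 <= 1 + `|u 0%N - ub| by rewrite addr_ge0.
have [d [kappa [d0 kappa0 err]]] :=
  subgradient_error_bound K_bounded alpha_gt0 K_FBI sub B0.
(* In the threshold, 1 bounds [|y n - u n|] and [d / M] ensures [|v n| <= d]. The last constant adds
   [|u n - y n| <= rho] and [|y n - ub| <= kappa M rho]. *)
apply: (@fejer_Q_linearly _ _ _ _ ((1 - sigma ^+ 2) / 2) (Num.min 1 (d / M))
  (1 + kappa * M)).
- exact: theta_gt0.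
- by rewrite lt_min ltr01 divr_gt0.
- by rewrite addr_gt0// mulr_gt0.
move=> n; have [rho [v_rho yu_rho u_rho]] :=
  advances_fejer K_bounded alpha_gt0 sigma_ge0_lt1 sub (run n).
have [/outer_step_accepted[_ /(accepted_subgradient alpha_gt0) suby] _ _] := run n.
clear run; have rho0 : 0 <= rho := le_trans (normr_ge0 _) yu_rho.
exists rho; split=> // rho_r u_dec.
have vM : `|v n| <= M * rho.
  by apply: le_trans v_rho _; rewrite ler_wpM2r// le_max muM0.
have vd : `|v n| <= d.
  apply: le_trans vM _; rewrite mulrC -ler_pdivlMr//.
  by apply: le_trans rho_r _; rewrite ge_min lexx orbT.
have yB : `|y n - ub| <= 1 + `|u 0%N - ub|.
  rewrite -[y n](subrK (u n)) -addrA; apply: le_trans (ler_normD _ _) _.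
  apply: lerD u_dec; apply: le_trans yu_rho _.
  by apply: le_trans rho_r _; rewrite ge_min lexx.
rewrite -[u n](subrK (y n)) -addrA; apply: le_trans (ler_normD _ _) _.
rewrite mulrDl mul1r distrC; apply: lerD => //.
by apply: le_trans (err _ _ suby yB vd) _; rewrite -mulrA ler_wpM2l// ltW.
Qed.
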